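(* Assume that $(E_F)$ holds. Then there are constants $C,\gamma>0$ such that, for any precompact ball $B(x,R)$ with $x\in M\setminus\mathcal N_0$ and for any $t>0$, $$\mathbb P_x\bigl(\tau_{B(x,R)}\le t\bigr)\le C\exp\bigl(-\Phi(\gamma R,t)\bigr),\qquad\text{where}\quad \Phi(R,t)=\sup_{r>0}\Bigl\{\frac Rr-\frac t{F(r)}\Bigr\}.$$
   Context: Setting. $(M,d)$ is a locally compact separable metric space, $\mu$ is a Radon measure on $M$ with full support, and $(\mathcal E,\mathcal F)$ is a regular, strongly local Dirichlet form in $L^2(M)=L^2(M,\mu)$ (regular: $\mathcal F\cap C_0(M)$ is dense both in $\mathcal F$ and in $C_0(M)$, the continuous compactly supported functions with sup-norm; strongly local: $\mathcal E(f,g)=0$ for all $f,g\in\mathcal F$ such that $g$ has compact support and $f$ is constant in a neighborhood of $\operatorname{supp} g$). $\mathcal L$ is its generator and $P_t=e^{-t\mathcal L}$ the heat semigroup (extended to all $L^q$). $B(x,r)$ is the open metric ball. Process. $(\{X_t\}_{t\ge0},\{\mathbb P_x\}_{x\in M\setminus\mathcal N_0})$ is a fixed diffusion process associated with $(\mathcal E,\mathcal F)$, with initial points outside a properly exceptional set $\mathcal N_0$: $\mathbb E_xf(X_t)=P_tf(x)$ for $\mu$-a.a. $x$, for all Borel $f\in L^q(M)$, $1\le q\le\infty$ ($f$ extended by $0$ to the cemetery). A set $\mathcal N\subset M$ is properly exceptional if it is Borel, $\mu(\mathcal N)=0$ and $\mathbb P_x(X_t\in\mathcal N\text{ for some }t\ge0)=0$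 for all $x\in M\setminus\mathcal N$. For open $\Omega\subset M$, $\tau_\Omega=\inf\{t>0:X_t\notin\Omega\}$. Function $F$. $F:(0,\infty)\to(0,\infty)$ is a fixed continuous increasing bijection such that for some constants $1<\beta\le\beta'$, $C>1$ and all $0<r\le R$, $C^{-1}(R/r)^{\beta}\le F(R)/F(r)\le C(R/r)^{\beta'}$. Condition $(E_F)$: there is $C>1$ with $C^{-1}F(r)\le\mathbb E_x\tau_{B(x,r)}\le CF(r)$ for all $x\in M\setminus\mathcal N_0$, $r>0$. *)

(* Defs.v *)
From HB Require Import structures.
From mathcomp Require Import all_boot all_order all_algebra.
From mathcomp Require Import all_classical all_reals all_analysis.
From mathcomp Require Import measurable_realfun.

Set Implicit Arguments.
Unset Strict Implicit.
Unset Printing Implicit Defensive.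

Import Order.TTheory GRing.Theory Num.Theory.
Import numFieldNormedType.Exports.

Local Open Scope classical_set_scope.
Local Open Scope ring_scope.

HB.mixin Record isBorel (d : measure_display) M
    & Topological M & Measurable d M := {
  borelE : @measurable d M = <<s @open M >>
}.

#[short(type="borelMetricType")]
HB.structure Definition BorelMetric (K : numDomainType) (d : measure_display) :=
  { M of Metric K M & Measurable d M & isBorel d M }.

Definition separable (T : topologicalType) : Prop :=
  exists2 D : set T, countable D & dense D.

Section measures.
Context {R : realType} {d : measure_display} {M : borelMetricType R d}.
Implicit Types (mu : {measure set M -> \bar R}).

Record radon mu : Prop := {
  radon_compact : forall K : set M, compact K -> (mu K < +oo)%E ;
  radon_outer : forall A : set M, measurable A ->
    mu A = ereal_inf [set mu U | U in [set U | open U /\ A `<=` U]] ;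
  radon_inner : forall U : set M, open U ->
    mu U = ereal_sup [set mu K | K in [set K | compact K /\ K `<=` U]] }.

Definition full_support mu : Prop :=
  forall U : set M, open U -> U !=set0 -> (0 < mu U)%E.

End measures.

(** Elements of the L^p spaces are represented by functions
    [M -> R]; domains of forms are sets of representatives that are saturated
    for equality almost everywhere. *)

Section dirichlet.
Context {R : realType} {d : measure_display} {M : borelMetricType R d}.
Variable mu : {measure set M -> \bar R}.
Implicit Types (f g h : M -> R) (dom : set (M -> R))
  (E : (M -> R) -> (M -> R) -> R).

Definition L2norm f : \bar R := 'N[mu]_2%:E [EFin \o f].

Definition L2dot f g : R := (\int[mu]_x (f x * g x))%R.

Definition L2 : set (M -> R) := [set f | f \in Lfun mu 2%:E].

Definition E1 E f : R := E f f + L2dot f f.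

Record dirichlet_form dom E : Prop := {
  df_L2 : dom `<=` L2 ;
  df_ae : forall f g, dom f -> L2 g -> f = g %[ae mu] ->
    dom g /\ forall h, dom h -> E f h = E g h ;
  df_dom0 : dom (cst 0) ;
  df_domZD : forall (a : R) f g, dom f -> dom g -> dom (a *: f + g) ;
  df_dense : forall f (e : R), L2 f -> 0 < e ->
    exists2 g, dom g & (L2norm (f - g)%R < e%:E)%E ;
  df_sym : forall f g, dom f -> dom g -> E f g = E g f ;
  df_linear : forall (a : R) f g h, dom f -> dom g -> dom h ->
    E (a *: f + g) h = a * E f h + E g h ;
  df_ge0 : forall f, dom f -> 0 <= E f f ;
  df_closed : forall u : nat -> M -> R, (forall n, dom (u n)) ->
    (forall e : R, 0 < e ->
       \forall m & n \near \oo, E1 E (u m - u n) < e) ->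
    exists2 f, dom f & (fun n => E1 E (u n - f)) @ \oo --> (0 : R) ;
  df_markov : forall f, dom f ->
    let g := fun x => Num.min (Num.max (f x) 0) 1 in
    dom g /\ E g g <= E f f }.

Definition Cc : set (M -> R) :=
  [set f | continuous f /\ compact (closure [set x | f x != 0])].

Record regular_form dom E : Prop := {
  regular_dom : forall f (e : R), dom f -> 0 < e ->
    exists2 g, (dom `&` Cc) g & E1 E (f - g) < e ;
  regular_Cc : forall f (e : R), Cc f -> 0 < e ->
    exists2 g, (dom `&` Cc) g & forall x, `|f x - g x| < e }.

(* The support of an L^2 function, i.e. of the measure [f . mu]; it depends
   only on the class of [f]. *)
Definition ess_support f : set M :=
  ~` \bigcup_(U in [set U | open U /\ {ae mu, forall x, U x -> f x = 0}]) U.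

Definition strongly_local dom E : Prop :=
  forall f g, dom f -> dom g -> compact (ess_support g) ->
    (exists (U : set M) (c : R), [/\ open U, ess_support g `<=` U &
       {ae mu, forall x, U x -> f x = c}]) ->
    E f g = 0.

(* [generator dom E f g] means that [f] is in the domain of the (nonnegative)
   generator [L] of the form and that [L f = g]. *)
Definition generator dom E f g : Prop :=
  [/\ dom f, L2 g & forall h, dom h -> E f h = L2dot g h].

(* [P t = exp (- t L)] on L^2: the strongly continuous contraction semigroup
   whose infinitesimal generator is [- L]. *)
Record heat_semigroup_L2 dom E (P : R -> (M -> R) -> (M -> R)) : Prop := {
  hs_L2 : forall (t : R) f, 0 <= t -> L2 f -> L2 (P t f) ;
  hs_ae : forall (t : R) f g, 0 <= t -> L2 f -> L2 g -> f = g %[ae mu] ->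
    P t f = P t g %[ae mu] ;
  hs_linear : forall (t a : R) f g, 0 <= t -> L2 f -> L2 g ->
    P t (a *: f + g) = a *: P t f + P t g %[ae mu] ;
  hs_contraction : forall (t : R) f, 0 <= t -> L2 f ->
    (L2norm (P t f) <= L2norm f)%E ;
  hs_0 : forall f, L2 f -> P 0 f = f %[ae mu] ;
  hs_D : forall (s t : R) f, 0 <= s -> 0 <= t -> L2 f ->
    P (s + t) f = P s (P t f) %[ae mu] ;
  hs_cvg : forall f, L2 f ->
    L2norm (P t f - f) @[t --> 0^'+] --> 0%E ;
  hs_generator : forall f g, L2 f -> L2 g ->
    (L2norm (t^-1 *: (f - P t f) - g) @[t --> 0^'+] --> 0%E
     <-> generator dom E f g) }.

(* The extension of the semigroup from L^2 to all L^q, 1 <= q <= +oo.  It is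
   determined by monotone limits of L^2 functions; for q < +oo this agrees with
   the extension by density of L^2 in L^q. *)
Record Lq_extension (P : R -> (M -> R) -> (M -> R)) : Prop := {
  ext_Lq : forall (t : R) (q : \bar R) f, 0 <= t -> (1 <= q)%E ->
    f \in Lfun mu q -> P t f \in Lfun mu q ;
  ext_split : forall (t : R) (q : \bar R) f, 0 <= t -> (1 <= q)%E ->
    f \in Lfun mu q ->
    P t f = P t (fun x => Num.max (f x) 0) - P t (fun x => Num.max (- f x) 0)
      %[ae mu] ;
  ext_monotone : forall (t : R) (q : \bar R) f (u : nat -> M -> R),
    0 <= t -> (1 <= q)%E -> f \in Lfun mu q ->
    (forall n, L2 (u n)) -> (forall n x, 0 <= u n x <= u n.+1 x) ->
    {ae mu, forall x, u ^~ x @ \oo --> f x} ->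
    {ae mu, forall x, (fun n => P t (u n) x) @ \oo --> P t f x} }.

Definition heat_semigroup dom E (P : R -> (M -> R) -> (M -> R)) : Prop :=
  heat_semigroup_L2 dom E P /\ Lq_extension P.

End dirichlet.

(** The state space of a process on [M] is the one-point compactification of
    [M], whose additional point [None] is the cemetery. *)

Section process.
Context {R : realType} {d : measure_display} {M : borelMetricType R d}.
Context {d' : measure_display} {Omega : measurableType d'}.
Local Notation Mext := (one_point_compactification M).
Implicit Types (X : R -> Omega -> Mext) (theta : R -> Omega -> Omega)
  (Ft : R -> set (set Omega)) (PP : M -> probability Omega R) (N : set M)
  (sigma : Omega -> \bar R).

Definition path_events X : set (set Omega) :=
  <<s [set X t @^-1` B | t in `[0, +oo[ & B in @open Mext] >>.

Record filtration Ft : Prop := {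
  filtration_sigma : forall t : R, 0 <= t -> sigma_algebra setT (Ft t) ;
  filtration_sub : forall t : R, 0 <= t -> Ft t `<=` measurable ;
  filtration_mono : forall s t : R, 0 <= s -> s <= t -> Ft s `<=` Ft t ;
  filtration_right : forall t : R, 0 <= t -> \bigcap_(s in `]t, +oo[) Ft s = Ft t }.

Definition stopping_time Ft sigma : Prop :=
  (forall w, 0 <= sigma w)%E /\
  forall t : R, 0 <= t -> Ft t [set w | (sigma w <= t%:E)%E].

(* the sigma-algebra [F_sigma] *)
Definition stopped Ft sigma : set (set Omega) :=
  [set A | measurable A /\
    forall t : R, 0 <= t -> Ft t (A `&` [set w | (sigma w <= t%:E)%E])].

Definition at_time X sigma (w : Omega) : Mext := X (fine (sigma w)) w.

(* [sigma] is finite and [X_sigma] is a legitimate starting point *)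
Definition live N X sigma : set Omega :=
  [set w | (sigma w < +oo)%E /\ (Some @` ~` N) (at_time X sigma w)].

(* [P_z A]; the value at the cemetery is irrelevant *)
Definition law_at PP (z : Mext) (A : set Omega) : \bar R :=
  if z is Some y then PP y A else 0%E.

Definition strong_markov N X theta Ft PP : Prop :=
  forall x sigma A B, ~ N x -> stopping_time Ft sigma -> stopped Ft sigma A ->
    path_events X B ->
    PP x (A `&` live N X sigma `&` [set w | B (theta (fine (sigma w)) w)]) =
    (\int[PP x]_(w in A `&` live N X sigma) law_at PP (at_time X sigma w) B)%E.

Definition properly_exceptional (mu : {measure set M -> \bar R}) X PP N : Prop :=
  [/\ measurable N, mu N = 0%E &
    forall x, ~ N x ->
      (PP x).-negligible [set w | exists2 t, 0 <= t & (Some @` N) (X t w)]].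

(* Only the laws [PP x] with [x] outside [N] are constrained.  Every path is
   continuous on [0, +oo[ in the one-point compactification, so that it can
   reach the cemetery only by leaving every compact subset of [M]: there is no
   killing inside.  [A] and [B] in the strong Markov property range over the
   past [F_sigma] and over the sigma-algebra generated by the process. *)
Record diffusion N X theta Ft PP : Prop := {
  diff_filtration : filtration Ft ;
  diff_adapted : forall (t : R) (U : set Mext), 0 <= t -> open U ->
    Ft t (X t @^-1` U) ;
  diff_continuous : forall w, {within `[0, +oo[, continuous (X ^~ w)} ;
  diff_cemetery : forall (s t : R) w, 0 <= s -> s <= t -> X s w = None ->
    X t w = None ;
  diff_shift : forall (s t : R) w, 0 <= s -> 0 <= t ->
    X s (theta t w) = X (t + s) w ;
  diff_kernel : forall A, path_events X A ->
    measurable_fun (~` N) (fun x => PP x A) ;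
  diff_start : forall x, ~ N x -> PP x [set w | X 0 w = Some x] = 1%E ;
  diff_markov : strong_markov N X theta Ft PP }.

Definition extend0 (f : M -> R) (z : Mext) : R := if z is Some y then f y else 0.

Definition associated (mu : {measure set M -> \bar R})
    (P : R -> (M -> R) -> (M -> R)) X PP : Prop :=
  forall (t : R) (q : \bar R) (f : M -> R), 0 < t -> (1 <= q)%E -> f \in Lfun mu q ->
    {ae mu, forall x,
      (\int[PP x]_w (extend0 f (X t w))%:E)%E = (P t f x)%:E}.

Definition exit_time X (U : set M) (w : Omega) : \bar R :=
  ereal_inf [set t%:E | t in [set t : R | 0 < t /\ ~ (Some @` U) (X t w)]].

Definition cond_EF (F : R -> R) N X PP : Prop :=
  exists2 C : R, 1 < C & forall (x : M) (r : R), ~ N x -> 0 < r ->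
    ((C^-1 * F r)%:E <= \int[PP x]_w exit_time X (ball x r) w /\
     \int[PP x]_w exit_time X (ball x r) w <= (C * F r)%:E)%E.

End process.

Section scale.
Context {R : realType}.
Implicit Type F : R -> R.

Record scale_function F : Prop := {
  scale_bij : set_bij `]0, +oo[ `]0, +oo[ F ;
  scale_continuous : {within `]0, +oo[, continuous F} ;
  scale_increasing : {in `]0, +oo[ &, {homo F : r s / r < s}} ;
  scale_bounds : exists beta beta' C : R, [/\ 1 < beta, beta <= beta', 1 < C &
    forall r s : R, 0 < r -> r <= s ->
      C^-1 * (s / r) `^ beta <= F s / F r <= C * (s / r) `^ beta'] }.

(* extended-real valued, hence the true supremum for all arguments *)
Definition Phi F (rho t : R) : \bar R :=
  ereal_sup [set (rho / r - t / F r)%:E | r in `]0, +oo[].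

End scale.

(* Main.v *)
Require Import Defs.
From HB Require Import structures.
From mathcomp Require Import all_boot all_order all_algebra.
From mathcomp Require Import all_classical all_reals all_analysis.
From mathcomp Require Import measurable_realfun.
From mathcomp Require Import ring lra.

Set Implicit Arguments.
Unset Strict Implicit.
Unset Printing Implicit Defensive.

Import Order.TTheory GRing.Theory Num.Theory.
Import numFieldNormedType.Exports.

Local Open Scope classical_set_scope.
Local Open Scope ring_scope.

(** The exit time [tau] of a ball of radius [r] has mean of order [F r] from the
    centre, and at most of this order from the other points of the ball; this
    prevents it from being small with probability close to one.  Indeed the upper bound on the mean, Markov's
    inequality and the Markov property give [tau] a geometric tail at scale
    [F r] after any time [t], so that [E tau <= t + K F(r) P(tau > t)]; with the
    lower bound [E tau >= F(r) / C] and [t] a small multiple [delta F(r)], the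
    probability [P(tau > t)] is bounded below.  Hence
    [P(tau <= delta F(r)) <= p] with [p < 1] independent of the centre and of
    the radius ([small_exit]).

    To leave the ball [B(x, r)] with [r >= n rho], the path must cross the [n]
    concentric balls [B(x, k rho)].  Let [T_k] be the exit time of the [k]-th one
    and [s = delta F(rho)].  At time [T_k] the path is at distance at most
    [k rho] from [x], so that the next crossing takes at least the time needed
    to leave a ball of radius [rho] centred at the present position, and by the
    strong Markov property it takes at most [s] with conditional probability at
    most [p].  Splitting [T_(k+1) <= t] according to whether [T_k <= t - s] gives
    [P(T_(k+1) <= t) <= (1 - p) P(T_k <= t - s) + p P(T_k <= t)]
    ([exit_step]), whence by induction
    [P(T_n <= t) <= ((1 + p) / 2)^(n - 1) exp(t / s)] ([exit_concentric]).
    This replaces Laplace transforms of exit times by a recursion that only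
    involves probabilities of events.

    Choosing [n] as the integer part of [r / rho] yields
    [P(tau <= t) <= C exp(- (c r / rho - t / (delta F(rho))))] for every [rho > 0]
    ([exit_exponential]).  Since [F] grows at least linearly, the substitution
    [rho = kappa u] with a large constant [kappa] absorbs [delta], and the
    supremum over [u] in the exponent is [Phi]. *)

(** * Sigma-algebras as predicates *)

Section sigma_algebra_closure.
Context {T : Type} (G : set (set T)).
Hypothesis sG : sigma_algebra setT G.

Lemma salg_not (P : T -> Prop) : G [set w | P w] -> G [set w | ~ P w].
Proof. by case: sG => _ + _ => /[apply]; rewrite setTD. Qed.

Lemma salg_ex (I : countType) (P : I -> T -> Prop) :
  (forall i, G [set w | P i w]) -> G [set w | exists i, P i w].
Proof.
case: sG => G0 _ GU GP.
pose Q n := if @unpickle I n is Some i then [set w | P i w] else set0.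
suff -> : [set w | exists i, P i w] = \bigcup_n Q n.
  by apply: GU => n; rewrite /Q; case: unpickle.
apply/seteqP; split=> w /=; first by case=> i Pi; exists (pickle i); rewrite // /Q pickleK.
by case=> n _; rewrite /Q; case: unpickle => // i Pi; exists i.
Qed.

Lemma salg_all (I : countType) (P : I -> T -> Prop) :
  (forall i, G [set w | P i w]) -> G [set w | forall i, P i w].
Proof.
move=> GP; suff -> : [set w | forall i, P i w] = [set w | ~ exists i, ~ P i w].
  by apply: salg_not; apply: salg_ex => i; apply: salg_not.
apply/seteqP; split=> w /=; first by move=> Pw [i]; apply.
by move=> nP i; apply: contrapT => Pi; apply: nP; exists i.
Qed.

Lemma salg_cst (P : Prop) : G [set w | P].
Proof.
case: sG => G0 GC _; have [p|np] := pselect P.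
  suff -> : [set w : T | P] = setT by rewrite -[setT]setD0; exact: GC.
  by apply/seteqP; split.
by suff -> : [set w : T | P] = set0 by []; apply/seteqP; split.
Qed.

Lemma salg_and (P Q : T -> Prop) : G [set w | P w] -> G [set w | Q w] ->
  G [set w | P w /\ Q w].
Proof.
move=> GP GQ; suff -> : [set w | P w /\ Q w] =
    [set w | forall b : bool, if b then P w else Q w].
  by apply: salg_all => -[].
apply/seteqP; split=> w /=; first by case=> ? ? [].
by move=> PQ; split; [exact: (PQ true)|exact: (PQ false)].
Qed.

Lemma salg_or (P Q : T -> Prop) : G [set w | P w] -> G [set w | Q w] ->
  G [set w | P w \/ Q w].
Proof.
move=> GP GQ; suff -> : [set w | P w \/ Q w] =
    [set w | exists b : bool, if b then P w else Q w].
  by apply: salg_ex => -[].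
apply/seteqP; split=> w /=; first by case=> ?; [exists true|exists false].
by case=> -[]; [left|right].
Qed.

Lemma salg_imp (P : Prop) (Q : T -> Prop) : (P -> G [set w | Q w]) ->
  G [set w | P -> Q w].
Proof.
move=> GQ; have [p|np] := pselect P.
  suff -> : [set w | P -> Q w] = [set w | Q w] by exact: GQ.
  by apply/seteqP; split=> w /=; [apply|move=> Qw _].
suff -> : [set w | P -> Q w] = [set w | True] by exact: salg_cst.
by apply/seteqP; split=> w //= _ p.
Qed.

End sigma_algebra_closure.

(** * A closed exhaustion of an open set *)

Section interior_exhaustion.
Context {R : realType} {M : metricType R}.
Implicit Types (U : set M) (x y : M).

(** Each [inner U n] is closed, and every point of the open set [U] has a
    neighbourhood contained in [inner U n] for all large [n]; this is what allows
    conditions on paths to be tested at rational times only. *)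
Definition inner U (n : nat) : set M := [set y | ball y n.+1%:R^-1 `<=` U].

Lemma inner_sub U n : inner U n `<=` U.
Proof. by move=> y; apply; apply: ballxx; rewrite invr_gt0. Qed.

Lemma inner_closed U n : closed (inner U n).
Proof.
move=> y cy z; rewrite ballEmdist /= => yz.
have e0 : 0 < n.+1%:R^-1 - mdist y z by rewrite subr_gt0.
have [y' [Uy' yy']] := cy _ (nbhsx_ballx y _ e0).
apply: Uy'; move: yy'; rewrite !ballEmdist /= => yy'.
apply: le_lt_trans (metric_triangle y' y z) _.
by rewrite (metric_sym y' y) -ltrBrDr.
Qed.

Lemma inner_near U y : open U -> U y ->
  \forall y' \near y & n \near \oo, inner U n y'.
Proof.
move=> oU Uy.
have /nbhs_ballP[e /= e0 eU] : nbhs y U by exact: open_nbhs_nbhs.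
have e20 : 0 < e / 2 by rewrite divr_gt0.
near=> y' n.
have ne : n.+1%:R^-1 <= e / 2.
  by near: n; have := near_infty_natSinv_lt (PosNum e20); apply: filterS => m /ltW.
have yy' : ball y (e / 2) y' by near: y'; exact: nbhsx_ballx.
move=> z yz; apply: eU; rewrite [e]splitr.
exact: ball_triangle yy' (le_ball ne yz).
Unshelve. all: by end_near. Qed.

Lemma open_mball x (r : R) : open (ball x r).
Proof.
rewrite openE => y; rewrite ballEmdist /= => xy; apply/nbhs_ballP.
exists (r - mdist x y) => /=; first by rewrite subr_gt0.
move=> z; rewrite !ballEmdist /= => yz.
by have := metric_triangle x y z; lra.
Qed.

End interior_exhaustion.

(** * Paths and exit times *)

Section paths.
Context {R : realType} {d : measure_display} {M : borelMetricType R d}.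
Context {d' : measure_display} {Omega : measurableType d'}.
Variables (N0 : set M) (X : R -> Omega -> one_point_compactification M)
  (theta : R -> Omega -> Omega) (Ft : R -> set (set Omega))
  (PP : M -> probability Omega R).
Hypothesis XD : diffusion N0 X theta Ft PP.
Implicit Types (U A : set M) (w : Omega) (s t u v : R).

Definition inside A t : set Omega := [set w | (Some @` A) (X t w)].

Lemma inside_sub A U t w : A `<=` U -> inside A t w -> inside U t w.
Proof. by move=> AU [y /AU Uy yX]; exists y. Qed.

Lemma path_near w t (V : set (one_point_compactification M)) :
  0 <= t -> open V -> V (X t w) ->
  exists2 e, 0 < e & forall u, 0 <= u -> `|u - t| < e -> V (X u w).
Proof.
move=> t0 oV VX; have /subspace_continuousP Xc := @Defs.diff_continuous _ _ _ _ _ _ _ _ _ _ XD w.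
have t_in : [set` `[0, +oo[] t by rewrite /= in_itv /= t0.
have : nbhs (X t w) V by exact: open_nbhs_nbhs.
move=> /(Xc t t_in) /nbhs_ballP[e /= e0 eV]; exists e => // u u0 ut.
apply: eV; last by rewrite in_itv /= u0.
by rewrite /ball /= distrC.
Qed.

(** A path that is alive at time [t] was alive before, the cemetery being a
    trap. *)
Lemma inside_before w s t : 0 <= s -> s <= t ->
  inside setT t w -> inside setT s w.
Proof.
move=> s0 st [y _ Xt]; rewrite /inside /=.
case Xs : (X s w) => [z|]; first by exists z.
by move: Xt; rewrite (diff_cemetery XD s0 st Xs).
Qed.

Lemma exit_time_ge0 U w : (0 <= exit_time X U w)%E.
Proof.
by apply: le_ereal_inf_tmp => _ [t [t0 _] <-]; rewrite lee_fin ltW.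
Qed.

Lemma exit_time_sub U A w : U `<=` A -> (exit_time X U w <= exit_time X A w)%E.
Proof.
move=> UA; apply: ereal_inf_le_tmp => _ [t [t0 nA] <-].
by exists t => //; split=> //; apply: contra_not nA; exact: inside_sub.
Qed.

Lemma le_exit_timeP U w s :
  (s%:E <= exit_time X U w)%E <-> (forall v, 0 < v -> v < s -> inside U v w).
Proof.
split=> [sU v v0 vs|sU].
  apply: contrapT => nU; move: sU; apply/negP; rewrite -ltNge.
  apply: (@le_lt_trans _ _ v%:E); last by rewrite lte_fin.
  by apply: ereal_inf_lbound; exists v.
apply: le_ereal_inf_tmp => _ [t [t0 nU] <-]; rewrite lee_fin leNgt.
by apply/negP => ts; apply: nU; exact: sU.
Qed.

(** Paths that stay in [U] during [ [a, b] ] stay in one member of the closed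
    exhaustion, by compactness; conversely a closed set only has to be tested
    at rational times, a passage at the cemetery being excluded because it would
    be visible at all later rational times. *)
Lemma stay_ratP U w s : open U ->
  (forall v, 0 < v -> v < s -> inside U v w) <->
  (forall a b : rat, 0 < ratr a :> R -> ratr b < s ->
    exists n, forall q : rat, ratr a <= ratr q :> R -> ratr q <= ratr b :> R ->
      inside (inner U n) (ratr q) w).
Proof.
move=> oU; split=> [sU a b a0 bs|sU v v0 vs].
  have h v : v \in `[ratr a, ratr b] -> \forall v' \near v & n \near \oo,
      v' \in `[ratr a, ratr b] -> inside (inner U n) v' w.
    rewrite in_itv /= => /andP[av vb].
    have v0 := lt_le_trans a0 av.
    have [y Uy Xv] := sU v v0 (le_lt_trans vb bs).
    have [[/= W Q] [Wy QF] WQ] := inner_near oU Uy.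
    have [e e0 eW] : exists2 e, 0 < e &
        forall u, 0 <= u -> `|u - v| < e -> inside W° u w.
      apply: path_near; first exact: ltW.
        by apply: one_point_compactification_open_some; exact: open_interior.
      by exists y.
    exists (ball v e, Q); first by split=> //; exact: nbhsx_ballx.
    move=> [v' n] [/= vv' Qn]; rewrite in_itv /= => /andP[av' _].
    have v'0 := ltW (lt_le_trans a0 av').
    have [|z Wz Xz] := eW v' v'0; first by rewrite distrC.
    by exists z => //; apply: (WQ (z, n)); split=> //=; exact: interior_subset.
  have /compact_near_coveringP/near_covering_withinP :=
    @segment_compact R (ratr a) (ratr b).
  move=> /(_ nat \oo (fun n v => inside (inner U n) v w) _ h)[n _ hn].
  exists n => q aq qb; apply: (hn n) => //=; rewrite in_itv /=; exact/andP.
have [a] := rat_in_itvoo v0; rewrite in_itv /= => /andP[a0 av].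
have [b] := rat_in_itvoo vs; rewrite in_itv /= => /andP[vb bs].
have [n hn] := sU a b a0 bs.
have [|||y _ Xv] := @inside_before w v (ratr b); [exact: ltW|exact: ltW| |].
  by apply: inside_sub (hn b _ _); rewrite ?lexx// ltW// (lt_trans av).
suff ny : inner U n y by exists y => //; exact: inner_sub ny.
apply: contrapT => ny.
have [e e0 eX] : exists2 e, 0 < e &
    forall u, 0 <= u -> `|u - v| < e -> inside (~` inner U n) u w.
  apply: path_near; first exact: ltW.
    by apply: one_point_compactification_open_some; apply: closed_openC; exact: inner_closed.
  by exists y.
have : v < Num.min (v + e) (ratr b) by rewrite lt_min vb ltrDl e0.
move=> /rat_in_itvoo[q]; rewrite in_itv /= lt_min => /and3P[vq qe qb].
have [z1 nz1 Xq1] : inside (~` inner U n) (ratr q) w.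
  apply: eX; first by rewrite ltW// (lt_trans v0).
  by rewrite ger0_norm ?subr_ge0 ?(ltW vq)// ltrBlDl.
have [z2 nz2] : inside (inner U n) (ratr q) w.
  by apply: hn; apply: ltW => //; exact: lt_trans vq.
by rewrite -Xq1 => -[z21]; apply: nz1; rewrite -z21.
Qed.

End paths.

(** * Measurability of exit times *)

Section exit_measurability.
Context {R : realType} {d : measure_display} {M : borelMetricType R d}.
Context {d' : measure_display} {Omega : measurableType d'}.
Variables (N0 : set M) (X : R -> Omega -> one_point_compactification M)
  (theta : R -> Omega -> Omega) (Ft : R -> set (set Omega))
  (PP : M -> probability Omega R).
Hypothesis XD : diffusion N0 X theta Ft PP.
Implicit Types (U A : set M) (w : Omega) (s t u v : R).

Section generic_sigma_algebra.
Variables (G : set (set Omega)) (s : R).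
Hypothesis sG : sigma_algebra setT G.
Hypothesis aG : forall t V, 0 <= t -> t < s -> open V -> G (X t @^-1` V).

Lemma inside_open_salg U t : open U -> 0 <= t -> t < s -> G (inside X U t).
Proof.
move=> oU t0 ts; apply: (aG t0 ts).
exact: one_point_compactification_open_some.
Qed.

Lemma inside_closed_salg A t : closed A -> 0 <= t -> t < s -> G (inside X A t).
Proof.
move=> cA t0 ts.
suff -> : inside X A t = [set w | inside X setT t w /\ ~ inside X (~` A) t w].
  apply: salg_and => //; first exact: inside_open_salg openT t0 ts.
  by apply: salg_not => //; apply: inside_open_salg => //; exact: closed_openC.
apply/seteqP; split=> w.
  case=> y Ay Xy; split; first by exists y.
  by case=> z nAz; rewrite -Xy => -[zy]; apply: nAz; rewrite zy.
case=> -[y _ Xy] nA; exists y => //; apply: contrapT => nAy.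
by apply: nA; exists y.
Qed.

Lemma exit_lt_salg U : open U -> G [set w | (exit_time X U w < s%:E)%E].
Proof.
move=> oU.
suff -> : [set w | (exit_time X U w < s%:E)%E] = [set w | ~ forall a b : rat,
    0 < ratr a :> R -> ratr b < s -> exists n, forall q : rat,
    ratr a <= ratr q :> R -> ratr q <= ratr b :> R ->
    inside X (inner U n) (ratr q) w].
  apply: salg_not => //; apply: salg_all => // a; apply: salg_all => // b.
  apply: salg_imp => // a0; apply: salg_imp => // bs; apply: salg_ex => // n.
  apply: salg_all => // q; apply: salg_imp => // aq; apply: salg_imp => // qb.
  apply: inside_closed_salg; first exact: inner_closed.
    exact: ltW (lt_le_trans a0 aq).
  exact: le_lt_trans bs.
apply/seteqP; split=> w /=.
  by move=> es /(stay_ratP XD _ _ oU)/le_exit_timeP; rewrite leNgt es.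
by rewrite ltNge => h; apply/negP => /le_exit_timeP/(stay_ratP XD _ _ oU).
Qed.

End generic_sigma_algebra.

Lemma exit_le_salg (G : set (set Omega)) t s U : sigma_algebra setT G ->
  (forall u V, 0 <= u -> u < s -> open V -> G (X u @^-1` V)) ->
  t < s -> open U -> G [set w | (exit_time X U w <= t%:E)%E].
Proof.
move=> sG aG ts oU.
suff -> : [set w | (exit_time X U w <= t%:E)%E] = [set w | forall q : rat,
    t < ratr q -> ratr q <= s -> (exit_time X U w < (ratr q)%:E)%E].
  apply: salg_all => // q; apply: salg_imp => // tq; apply: salg_imp => // qs.
  by apply: exit_lt_salg => // u V u0 uq; apply: aG => //; exact: lt_le_trans qs.
apply/seteqP; split=> w /=.
  by move=> et q tq qs; apply: le_lt_trans et _; rewrite lte_fin.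
move=> h; rewrite leNgt; apply/negP => te.
have [r [tr rs re]] : exists r : R, [/\ t < r, r <= s & (r%:E <= exit_time X U w)%E].
  case: (leP s%:E (exit_time X U w)) => [se|]; first by exists s.
  move: te; case: (exit_time X U w) => [r||] //=; rewrite !lte_fin => tr rs.
  by exists r; rewrite ltW.
have [q] := rat_in_itvoo tr; rewrite in_itv /= => /andP[tq qr].
have := h q tq (ltW (lt_le_trans qr rs)); apply/negP; rewrite -leNgt.
by apply: le_trans re; rewrite lee_fin ltW.
Qed.

Lemma exit_le_neg U t : t < 0 -> [set w | (exit_time X U w <= t%:E)%E] = set0.
Proof.
move=> t0; apply/seteqP; split=> w //= et.
by have := le_trans (exit_time_ge0 X U w) et; rewrite lee_fin leNgt t0.
Qed.

(** The event [tau <= t] depends on the path on any time interval [[0, s]] with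
    [s > t], and right-continuity of the filtration does the rest. *)
Lemma exit_stopping U : open U -> stopping_time Ft (exit_time X U).
Proof.
move=> oU; split=> [w|t t0]; first exact: exit_time_ge0.
have FF := diff_filtration XD.
rewrite -(filtration_right FF t0) => s /=; rewrite in_itv /= andbT => ts.
have s0 := ltW (le_lt_trans t0 ts).
apply: exit_le_salg ts oU; first exact: (filtration_sigma FF).
move=> u V u0 us oV; apply: (filtration_mono FF u0 (ltW us)).
exact: (diff_adapted XD).
Qed.

Lemma exit_path_events U t : open U ->
  path_events X [set w | (exit_time X U w <= t%:E)%E].
Proof.
move=> oU; have tt : t < t + 1 by rewrite ltrDl.
apply: exit_le_salg tt oU; first exact: smallest_sigma_algebra.
move=> u V u0 _ oV; apply: sub_sigma_algebra; exists u => //.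
  by rewrite /= in_itv /= u0.
by exists V.
Qed.

Lemma adapted_measurable t (V : set (one_point_compactification M)) :
  0 <= t -> open V -> measurable (X t @^-1` V).
Proof.
move=> t0 oV; apply: (filtration_sub (diff_filtration XD) t0).
exact: (diff_adapted XD).
Qed.

Lemma exit_le_measurable U t : open U ->
  measurable [set w | (exit_time X U w <= t%:E)%E].
Proof.
move=> oU; have tt : t < t + 1 by rewrite ltrDl.
apply: exit_le_salg tt oU; first exact: sigma_algebra_measurable.
by move=> u V u0 _; exact: adapted_measurable.
Qed.

Lemma exit_measurable U : open U -> measurable_fun setT (exit_time X U).
Proof.
move=> oU; apply: (measurability _ (ErealGenOInfty.measurableE R)).
move=> _ [_ [x ->] <-]; rewrite setTI.
suff -> : exit_time X U @^-1` `]x%:E, +oo[%classic =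
    ~` [set w | (exit_time X U w <= x%:E)%E].
  by apply: measurableC; exact: exit_le_measurable.
apply/seteqP; split=> w /=; rewrite in_itv /= andbT ltNge; first by move/negP.
by move/negP.
Qed.

(** The position [X_sigma] at a random time is recovered from rational times by
    right-continuity, which makes [X_sigma] measurable, tested first on open sets
    and then on Borel sets such as the complement of [N0]. *)
Lemma live_measurable (sigma : Omega -> \bar R) (A : set Omega) :
  measurable N0 -> measurable_fun setT sigma -> (forall w, 0 <= sigma w)%E ->
  measurable A ->
  (forall w, A w -> (sigma w < +oo)%E /\ (Some @` setT) (at_time X sigma w)) ->
  measurable (A `&` live N0 X sigma).
Proof.
move=> mN ms s0 mA As.
pose H : set (set M) :=
  [set B | measurable [set w | A w /\ (Some @` B) (at_time X sigma w)]].
have sm := @sigma_algebra_measurable _ Omega.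
suff HN : H (~` N0).
  suff -> : A `&` live N0 X sigma =
      [set w | A w /\ (Some @` (~` N0)) (at_time X sigma w)] by [].
  apply/seteqP; split=> w; first by case=> Aw [_].
  by case=> Aw XN; split => //; split => //; have [] := As w Aw.
have sH : sigma_algebra setT H.
  split.
  - rewrite /H /= (_ : [set w | _] = set0); first exact: measurable0.
    by apply/seteqP; split=> w //= -[_ [y []]].
  - move=> B HB; rewrite setTD /H /=.
    suff -> : [set w | A w /\ (Some @` (~` B)) (at_time X sigma w)] =
       A `\` [set w | A w /\ (Some @` B) (at_time X sigma w)].
      exact: measurableD.
    apply/seteqP; split=> w.
      case=> Aw [y nBy Xy]; split=> // -[_ [z Bz]]; rewrite -Xy => -[zy].
      by apply: nBy; rewrite -zy.
    case=> Aw nAB; split=> //; have [_ [y _ Xy]] := As w Aw.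
    by exists y => // By; apply: nAB; split => //; exists y.
  - move=> B HB; rewrite /H /=.
    suff -> : [set w | A w /\ (Some @` \bigcup_k B k) (at_time X sigma w)] =
       \bigcup_k [set w | A w /\ (Some @` B k) (at_time X sigma w)].
      exact: bigcupT_measurable.
    apply/seteqP; split=> w.
      by case=> Aw [y [k _ By] Xy]; exists k => //; split=> //; exists y.
    by case=> k _ [Aw [y By Xy]]; split=> //; exists y => //; exists k.
suff : <<s @open M >> `<=` H.
  by apply; rewrite -borelE; exact: measurableC.
apply: smallest_sub => // U oU; rewrite /H /=.
have slt (q : rat) : measurable [set w | (sigma w < (ratr q : R)%:E)%E].
  by rewrite -[X in measurable X]setTI; exact: emeasurable_fun_infty_o.
suff -> : [set w | A w /\ (Some @` U) (at_time X sigma w)] =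
    [set w | A w /\ exists n, exists b : rat, (sigma w < (ratr b)%:E)%E /\
      forall q : rat, 0 <= ratr q :> R -> ratr q < ratr b :> R ->
        ~ (sigma w < (ratr q)%:E)%E \/ inside X (inner U n) (ratr q) w].
  apply: salg_and => //; apply: salg_ex => // n; apply: salg_ex => // b.
  apply: salg_and => //; apply: salg_all => // q; apply: salg_imp => // q0.
  apply: salg_imp => // qb; apply: salg_or => //; first exact: salg_not.
  apply: (inside_closed_salg (s := ratr b)) => //; last exact: inner_closed.
  by move=> u V u0 _; exact: adapted_measurable.
apply/seteqP; split=> w [Aw].
  move=> [y Uy Xy]; split=> //.
  have [[/= W Q] [Wy [n _ Qn]] WQ] := inner_near oU Uy.
  have [soo _] := As w Aw.
  have sE : (fine (sigma w))%:E = sigma w by rewrite fineK// ge0_fin_numE.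
  have f0 : 0 <= fine (sigma w) by rewrite fine_ge0.
  have [e e0 eW] : exists2 e, 0 < e & forall u, 0 <= u ->
      `|u - fine (sigma w)| < e -> inside X W° u w.
    apply: (path_near XD) => //; last by exists y.
    by apply: one_point_compactification_open_some; exact: open_interior.
  have : fine (sigma w) < fine (sigma w) + e by rewrite ltrDl.
  move=> /rat_in_itvoo[b]; rewrite in_itv /= => /andP[sb be].
  exists n, b; split=> [|q q0 qb]; first by rewrite -sE lte_fin.
  have [sq|] := boolP (sigma w < (ratr q)%:E)%E; last by left.
  right; have [||z Wz Xz] := eW (ratr q) => //.
    move: sq; rewrite -sE lte_fin => sq.
    by rewrite ger0_norm ?subr_ge0 ?(ltW sq)// ltrBlDl; exact: lt_trans qb be.
  exists z => //; apply: (WQ (z, n)); split=> /=; last exact: (Qn n (leqnn n)).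
  exact: interior_subset.
move=> [n [b [sb hb]]]; split=> //; have [soo [y _ Xy]] := As w Aw.
have sE : (fine (sigma w))%:E = sigma w by rewrite fineK// ge0_fin_numE.
have f0 : 0 <= fine (sigma w) by rewrite fine_ge0.
suff ny : inner U n y by exists y => //; exact: inner_sub ny.
apply: contrapT => ny.
have [e e0 eX] : exists2 e, 0 < e & forall u, 0 <= u ->
    `|u - fine (sigma w)| < e -> inside X (~` inner U n) u w.
  apply: (path_near XD) => //; last by exists y.
  apply: one_point_compactification_open_some; apply: closed_openC.
  exact: inner_closed.
have : fine (sigma w) < Num.min (fine (sigma w) + e) (ratr b).
  by rewrite lt_min ltrDl e0 -lte_fin sE.
move=> /rat_in_itvoo[q]; rewrite in_itv /= lt_min => /and3P[sq qe qb].
have q0 : 0 <= ratr q :> R by rewrite ltW// (le_lt_trans f0).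
have [z1 nz1 Xq1] : inside X (~` inner U n) (ratr q) w.
  by apply: eX => //; rewrite ger0_norm ?subr_ge0 ?(ltW sq)// ltrBlDl.
have [|[z2 nz2]] := hb q q0 qb; first by rewrite -sE lte_fin.
by rewrite -Xq1 => -[z21]; apply: nz1; rewrite -z21.
Qed.

End exit_measurability.

(** * The strong Markov property with a uniform bound *)

(** The integral of a nonnegative function is a supremum over the simple functions
    below it, hence it is monotone also on non-measurable functions; it is applied
    to the law of the future seen from a random position and to exit times of
    balls of arbitrary centre. *)
Lemma ge0_le_integral_nonmeasurable d (T : measurableType d) (R : realType)
    (mu : {measure set T -> \bar R}) (f g : T -> \bar R) :
  (forall x, 0 <= f x)%E -> (forall x, f x <= g x)%E ->
  (\int[mu]_x f x <= \int[mu]_x g x)%E.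
Proof.
move=> f0 fg; rewrite !ge0_integralTE //; last by move=> x; exact: le_trans (fg x).
apply: ereal_sup_le => _ [h hf <-]; exists h => // x.
exact: le_trans (fg x).
Qed.

Lemma lee_real_lb (R : realType) (a b : \bar R) :
  (forall r : R, r%:E <= a -> r%:E <= b)%E -> (a <= b)%E.
Proof.
case: a => [r||] h; [exact: h| |exact: leNye].
case: b h => [r||] // h; have := h; last by move=> /(_ 0%R (leey _)).
by move=> /(_ (r + 1)%R (leey _)); rewrite lee_fin leNgt ltrDl ltr01.
Qed.

Section markov.
Context {R : realType} {d : measure_display} {M : borelMetricType R d}.
Context {d' : measure_display} {Omega : measurableType d'}.
Variables (mu : {measure set M -> \bar R}).
Variables (N0 : set M) (X : R -> Omega -> one_point_compactification M)
  (theta : R -> Omega -> Omega) (Ft : R -> set (set Omega))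
  (PP : M -> probability Omega R).
Hypothesis XD : diffusion N0 X theta Ft PP.
Hypothesis NE : properly_exceptional mu X PP N0.
Implicit Types (U : set M) (w : Omega) (s t u v : R).

(** Both sides are determined by their real lower bounds, and [r <= tau] means that
    the path stays in [U] during [(0, r)]; a shift by [s] translates this interval. *)
Lemma exit_shift U w s : 0 <= s ->
  (forall v, 0 < v -> v <= s -> inside X U v w) ->
  exit_time X U w = (s%:E + exit_time X U (theta s w))%E.
Proof.
move=> s0 sU.
have shiftE r : ((r - s)%:E <= exit_time X U (theta s w))%E <->
    (r%:E <= exit_time X U w)%E.
  split=> /le_exit_timeP h; apply/le_exit_timeP => v v0 vr.
    have [vs|sv] := leP v s; first exact: sU.
    have := h (v - s); rewrite subr_gt0 ltrD2r => /(_ sv vr).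
    by rewrite /inside /= (diff_shift XD) ?subr_ge0 ?(ltW sv)// addrC subrK.
  rewrite /inside /= (diff_shift XD) ?(ltW v0)//; apply: h.
    exact: ltr_wpDl.
  by rewrite addrC -ltrBrDr.
have lbE r : (r%:E <= s%:E + exit_time X U (theta s w))%E <->
    ((r - s)%:E <= exit_time X U (theta s w))%E.
  by rewrite addeC -leeBlDr// EFinB.
by apply/eqP; rewrite eq_le; apply/andP; split; apply: lee_real_lb => r;
  [move=> /shiftE/lbE|move=> /lbE/shiftE].
Qed.

(** Almost surely the path never meets [N0], so that on [A] the position at time
    [sigma] is a legitimate starting point and [A] may be replaced by its
    intersection with [live N0 X sigma] in the strong Markov property. *)
Lemma markov_bound x (sigma : Omega -> \bar R) (A B C : set Omega) (p : R) :
  ~ N0 x -> stopping_time Ft sigma -> measurable_fun setT sigma ->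
  stopped Ft sigma A -> path_events X B -> measurable C ->
  C = A `&` [set w | B (theta (fine (sigma w)) w)] -> 0 <= p ->
  (forall w, A w -> (sigma w < +oo)%E /\ exists2 y, Some y = at_time X sigma w &
     ~ N0 y -> (PP y B <= p%:E)%E) ->
  (PP x C <= p%:E * PP x A)%E.
Proof.
move=> Nx st ms sA pB mC CE p0 hA.
have mA : measurable A by case: sA.
have [mN _ /(_ x Nx) NN] := NE.
have [s0 _] := st.
have mL : measurable (A `&` live N0 X sigma).
  apply: (live_measurable XD) => // w Aw; have [? [y Xy _]] := hA w Aw.
  by split=> //; exists y.
rewrite (measureDI (PP x) mC mL) (measure_negligible (measurableD mC mL)).
  rewrite add0e (_ : C `&` _ =
      A `&` live N0 X sigma `&` [set w | B (theta (fine (sigma w)) w)]).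
    rewrite [leLHS](diff_markov XD Nx st sA pB).
    rewrite -(integral_cst (PP x) mA) [leLHS]integral_mkcond [leRHS]integral_mkcond.
    apply: ge0_le_integral_nonmeasurable => w.
      by apply: erestrict_ge0 => {}w _; rewrite /law_at; case: at_time.
    rewrite /patch; case: ifPn => [|_]; last first.
      by case: ifPn => // _; rewrite lee_fin.
    rewrite !inE => -[Aw [_ lw]]; rewrite mem_set//.
    have [_ [y Xy yp]] := hA w Aw; move: lw; rewrite -Xy => -[z Nz [zy]].
    by apply: yp; rewrite -zy.
  rewrite CE; apply/seteqP; split=> w; first by case=> -[Aw Bw] [_ lw].
  by case=> -[].
apply: negligibleS NN => w [Cw nL].
have [Aw Bw] : (A `&` [set w | B (theta (fine (sigma w)) w)]) w by rewrite -CE.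
have [soo [y Xy _]] := hA w Aw.
exists (fine (sigma w)); first exact: fine_ge0.
apply: contrapT => nN; apply: nL; split=> //; split=> //.
rewrite /= -Xy; exists y => // Ny; apply: nN; exists y => //.
Qed.

End markov.

(** * Exit from one ball *)

Section mean_and_tail.
Context {d' : measure_display} {Omega : measurableType d'} {R : realType}.
Variable P : probability Omega R.

Lemma probability_fineK (A : set Omega) : measurable A -> P A = (fine (P A))%:E.
Proof. by move=> mA; rewrite fineK// fin_num_measure. Qed.

(** Integrate the bound of [f] by [t] plus [T] times the number of [k] such that
    [f > t + k T]; the probabilities of these events sum to at most twice the
    first one. *)
Lemma mean_le_tail (f : Omega -> \bar R) (t T : R) :
  measurable_fun setT f -> (forall w, 0 <= f w)%E -> 0 <= t -> 0 < T ->
  (forall k, (P [set w | (t + k%:R * T)%:E < f w]%E <=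
              (2^-1 ^+ k)%:E * P [set w | t%:E < f w]%E)%E) ->
  (\int[P]_w f w <= t%:E + (2 * T)%:E * P [set w | t%:E < f w]%E)%E.
Proof.
move=> mf f0 t0 T0 tail.
pose S k := [set w | (t + k%:R * T)%:E < f w]%E.
have mS k : measurable (S k).
  by rewrite -[S k]setTI; exact: emeasurable_fun_o_infty.
have St : S 0%N = [set w | t%:E < f w]%E by rewrite /S mul0r addr0.
rewrite -St in tail *.
pose g k w := (T%:E * (\1_(S k) w)%:E)%E.
have g0 k w : (0 <= g k w)%E by rewrite mule_ge0// lee_fin// ltW.
have mg k : measurable_fun setT (g k).
  apply: measurable_funeM; apply/measurable_EFinP; exact: measurable_indic.
(* on [t + m T < f <= t + (m + 1) T] the series has exactly [m + 1] terms equal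
   to [T] *)
have fle w : (f w <= t%:E + \sum_(k <oo) g k w)%E.
  have part m : S m w -> ((m.+1%:R * T)%:E <= \sum_(k <oo) g k w)%E.
    move=> Sm; apply: le_trans (nneseries_lim_ge m.+1 (fun k _ _ => g0 k w)).
    rewrite (eq_big_nat _ _ (F2 := fun=> T%:E)).
      by rewrite sumEFin sumr_const_nat subn0 lee_fin mulr_natl.
    move=> k /andP[_ km]; rewrite /g indicE mem_set ?mule1//=.
    apply: le_lt_trans Sm; rewrite lee_fin lerD2l ler_pM2r// ler_nat.
    by rewrite -ltnS.
  have [Sall|] := pselect (forall m, S m w).
    suff -> : (\sum_(k <oo) g k w = +oo)%E by rewrite addey// leey.
    apply/eqyP => A A0; have := part (Num.bound (A / T)) (Sall _).
    apply: le_trans; rewrite lee_fin -ler_pdivrMr//.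
    rewrite ltW// (lt_trans (archi_boundP _)) ?ltr_nat//.
    by rewrite divr_ge0// ltW.
  move=> /existsNP[m0 nS]; have exn : exists m, ~~ `[< S m w >].
    by exists m0; apply/asboolPn.
  case: (ex_minnP exn) => -[|m] /asboolPn nSm minm.
    rewrite /S /= mul0r addr0 in nSm.
    have : (f w <= t%:E)%E by rewrite leNgt; apply/negP.
    by move=> /le_trans; apply; rewrite leeDl// nneseries_ge0.
  have Sm : S m w.
    by apply: contrapT => /asboolPn /minm; rewrite ltnn.
  have : (f w <= (t + m.+1%:R * T)%:E)%E by rewrite leNgt; apply/negP.
  by move=> /le_trans; apply; rewrite EFinD leeD2l// part.
have mG : measurable_fun setT (fun w => \sum_(k <oo) g k w)%E.
  by apply: ge0_emeasurable_sum => // k w _ _.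
have G0 w : (0 <= \sum_(k <oo) g k w)%E by apply: nneseries_ge0.
apply: (@le_trans _ _ (\int[P]_w (t%:E + \sum_(k <oo) g k w)))%E.
  by apply: ge0_le_integral_nonmeasurable.
rewrite ge0_integralD//.
have -> : (\int[P]_x t%:E = t%:E)%E.
  by rewrite (integral_cst P measurableT) -[RHS]mule1; congr (_ * _)%E; exact: probability_setT.
rewrite leeD2l//.
rewrite integral_nneseries//.
set p := fine (P (S 0%N)).
have pE : P (S 0%N) = p%:E by exact: probability_fineK.
have p0 : 0 <= p by rewrite fine_ge0.
apply: (@le_trans _ _ (\sum_(k <oo) ((2 * T * p) / (2 ^ (k + 1))%:R)%:E)%E).
  apply: lee_nneseries => k _ *; first exact: integral_ge0.
  rewrite /g.
  rewrite ge0_integralZl_EFin//; last 2 first.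
    by apply/measurable_EFinP; exact: measurable_indic.
    exact: ltW.
  rewrite integral_indic// setIT.
  apply: (@le_trans _ _ (T%:E * ((2^-1 ^+ k)%:E * p%:E)))%E.
    by rewrite lee_pmul2l ?lte_fin// -pE; exact: tail.
  rewrite -!EFinM lee_fin natrX addn1 exprS exprVn.
  rewrite [leRHS](_ : _ = T * (2 ^- k * p))//.
  by field; rewrite expf_neq0.
have -> : ((2 * T)%:E * P (S 0%N) = (2 * T * p / 2 ^+ 0)%:E)%E.
  by rewrite pE -EFinM expr0 divr1.
by have /cvg_lim -> := @cvg_geometric_eseries_half R (2 * T * p) 0.
Qed.

End mean_and_tail.

Section one_ball.
Context {R : realType} {d : measure_display} {M : borelMetricType R d}.
Context {d' : measure_display} {Omega : measurableType d'}.
Variables (mu : {measure set M -> \bar R}).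
Variables (N0 : set M) (X : R -> Omega -> one_point_compactification M)
  (theta : R -> Omega -> Omega) (Ft : R -> set (set Omega))
  (PP : M -> probability Omega R).
Hypothesis XD : diffusion N0 X theta Ft PP.
Hypothesis NE : properly_exceptional mu X PP N0.
Implicit Types (U : set M) (w : Omega) (s t u v : R).

Lemma exit_gt_measurable U t : open U ->
  measurable [set w | t%:E < exit_time X U w]%E.
Proof.
move=> oU; rewrite -[X in measurable X]setTI.
by apply: emeasurable_fun_o_infty => //; exact: (exit_measurable XD).
Qed.

Lemma exit_gt_inside U t w : 0 <= t -> (t%:E < exit_time X U w)%E ->
  forall v, 0 < v -> v <= t -> inside X U v w.
Proof.
move=> t0 te v v0 vt; have [r tr re] : exists2 r, t < r & (r%:E <= exit_time X U w)%E.
  move: te; case: (exit_time X U w) => [r||] //=; rewrite ?lte_fin => tr.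
    by exists r.
  by exists (t + 1); rewrite ?ltrDl// leey.
by move/le_exit_timeP : re; apply => //; exact: le_lt_trans tr.
Qed.

(** If [tau > c], the position at the deterministic time [c] is in [U], and the
    process must stay in [U] for [T] more units of time from there. *)
Lemma exit_tail_step U x (p c T : R) : open U -> ~ N0 x -> 0 < c -> 0 <= p ->
  (forall y, U y -> ~ N0 y ->
    (PP y [set w | T%:E < exit_time X U w]%E <= p%:E)%E) -> 0 <= T ->
  (PP x [set w | (c + T)%:E < exit_time X U w]%E <=
   p%:E * PP x [set w | c%:E < exit_time X U w]%E)%E.
Proof.
move=> oU Nx c0 p0 hT T0; have FF := diff_filtration XD; have c0' := ltW c0.
have sFt u : 0 <= u -> sigma_algebra setT (Ft u) by exact: (filtration_sigma FF).
have pathC t : path_events X [set w | t%:E < exit_time X U w]%E.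
  rewrite (_ : [set w | _] = [set w | ~ (exit_time X U w <= t%:E)%E]).
    have sP : sigma_algebra setT (path_events X) by exact: smallest_sigma_algebra.
    exact: salg_not sP _ (exit_path_events XD t oU).
  by apply/seteqP; split=> w /=; rewrite ltNge; move/negP.
apply: (markov_bound XD NE (sigma := cst c%:E)
  (B := [set w | T%:E < exit_time X U w]%E)) => //.
- split=> [w|t t0]; first by rewrite lee_fin.
  exact: (salg_cst (sFt t t0) (c%:E <= t%:E)%E).
- split; first exact: exit_gt_measurable.
  move=> t t0.
  suff -> : [set w | (c%:E < exit_time X U w)%E] `&` [set w | (cst c%:E w <= t%:E)%E] =
      [set w | c <= t /\ ~ (exit_time X U w <= c%:E)%E].
    have [ct|tc] := leP c t.
      apply: salg_and; [exact: sFt|exact: salg_cst (sFt t t0) _|].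
      apply: salg_not; first exact: sFt.
      apply: (filtration_mono FF c0' ct).
      by have [_] := exit_stopping XD oU; exact.
    suff -> : [set w | false /\ ~ (exit_time X U w <= c%:E)%E] = set0.
      by have [] := sFt t t0.
    by apply/seteqP; split => w // [].
  apply/seteqP; split=> w /=; rewrite lee_fin ltNge.
    by case=> /negP.
  by case=> ? /negP.
- exact: exit_gt_measurable.
- apply/seteqP; split=> w /=.
    move=> cTe; have ce : (c%:E < exit_time X U w)%E.
      by apply: le_lt_trans cTe; rewrite lee_fin lerDl.
    split=> //; move: cTe; rewrite (exit_shift XD c0' (exit_gt_inside c0' ce)).
    by rewrite EFinD lteD2lE.
  case=> ce; rewrite [in X in _ -> X](exit_shift XD c0' (exit_gt_inside c0' ce)).
  by rewrite EFinD lteD2lE.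
- move=> w /= ce; split; first by rewrite ltry.
  have [y Uy Xy] := exit_gt_inside c0' ce c0 (lexx c).
  by exists y => // Ny; exact: hT.
Qed.

End one_ball.

Section small_exit.
Context {R : realType} {d : measure_display} {M : borelMetricType R d}.
Context {d' : measure_display} {Omega : measurableType d'}.
Variables (mu : {measure set M -> \bar R}).
Variables (N0 : set M) (X : R -> Omega -> one_point_compactification M)
  (theta : R -> Omega -> Omega) (Ft : R -> set (set Omega))
  (PP : M -> probability Omega R) (F : R -> R).
Hypothesis XD : diffusion N0 X theta Ft PP.
Hypothesis NE : properly_exceptional mu X PP N0.

Lemma exit_tail_geometric (U : set M) x (t T : R) k : open U -> ~ N0 x -> 0 < t ->
  (forall y, U y -> ~ N0 y ->
    (PP y [set w | T%:E < exit_time X U w]%E <= (2^-1)%:E)%E) -> 0 <= T ->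
  (PP x [set w | (t + k%:R * T)%:E < exit_time X U w]%E <=
   (2^-1 ^+ k)%:E * PP x [set w | t%:E < exit_time X U w]%E)%E.
Proof.
move=> oU Nx t0 hT T0; elim: k => [|k IH]; first by rewrite mul0r addr0 expr0 mul1e.
rewrite -natr1 mulrDl mul1r addrA; apply: (le_trans (exit_tail_step XD NE oU Nx _ _ hT T0)).
- by rewrite ltr_wpDr// mulr_ge0.
- by rewrite invr_ge0.
by rewrite exprS EFinM -muleA lee_pmul2l ?lte_fin ?invr_gt0.
Qed.

(** Seen from a point [y] of the ball, the ball is contained in [ball y (2 * r)], and
    the bound is Markov's inequality for the exit time of the latter. *)
Lemma exit_tail_half x y (r m : R) : mdist x y < r -> 0 < m ->
  (\int[PP y]_w exit_time X (ball y (2 * r)) w <= m%:E)%E ->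
  (PP y [set w | (2 * m)%:E < exit_time X (ball x r) w]%E <= (2^-1)%:E)%E.
Proof.
move=> xy m0 mean.
have oB := open_mball x r; have mE := exit_measurable XD oB.
have sub : ball x r `<=` ball y (2 * r).
  move=> z; rewrite !ballEmdist /= => xz.
  by have := metric_triangle y x z; rewrite (metric_sym y x); lra.
have abs w : `|exit_time X (ball x r) w|%E = exit_time X (ball x r) w.
  by rewrite gee0_abs// exit_time_ge0.
have m20 : 0 < 2 * m by rewrite mulr_gt0.
have mge : measurable [set w | (2 * m)%:E <= exit_time X (ball x r) w]%E.
  by rewrite -[X in measurable X]setTI; exact: emeasurable_fun_c_infty.
have : ((2 * m)%:E * PP y [set w | (2 * m)%:E <= exit_time X (ball x r) w]%E <=
    m%:E)%E.
  have := le_integral_abse (PP y) measurableT mE m20.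
  under eq_integral do rewrite abs.
  rewrite setTI; under eq_set do rewrite abs.
  move=> h; apply: le_trans h (le_trans _ mean).
  apply: ge0_le_integral_nonmeasurable => w; first exact: exit_time_ge0.
  exact: exit_time_sub.
rewrite (probability_fineK (PP y) mge) -EFinM lee_fin => h.
apply: (@le_trans _ _ (PP y [set w | (2 * m)%:E <= exit_time X (ball x r) w]%E)).
  apply: le_measure; rewrite ?inE//; first exact: (exit_gt_measurable XD).
  by move=> w /= /ltW.
rewrite (probability_fineK (PP y) mge) lee_fin.
have : 2 * m * (fine (PP y [set w | (2 * m)%:E <= exit_time X (ball x r) w]%E) - 2^-1) <= 0.
  by rewrite mulrBr; lra.
by rewrite pmulr_rle0// subr_le0.
Qed.

(** With [m = C F(2 r)], the tail of [tau] decays by one half over each time interval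
    of length [2 m], which gives [F(r) / C <= t + 4 m P(tau > t)] with [m] at most a
    constant times [F r].  The choice [t = F(r) / (2 C)] makes the last term at
    least [F(r) / (2 C)]. *)
Lemma small_exit : scale_function F -> cond_EF F N0 X PP ->
  exists delta p : R, [/\ 0 < delta, delta < 1, 0 < p, p < 1 &
    forall x r, ~ N0 x -> 0 < r ->
    (PP x [set w | exit_time X (ball x r) w <= (delta * F r)%:E]%E <= p%:E)%E].
Proof.
move=> Fs [C C1 EF].
have [b [b' [CF [b1 _ CF1 hF]]]] := scale_bounds Fs.
have C0 : 0 < C by rewrite (lt_trans ltr01).
have CF0 : 0 < CF by rewrite (lt_trans ltr01).
have F0 r : 0 < r -> 0 < F r.
  move=> r0; have [+ _ _] := scale_bij Fs.
  by move=> /(_ r) /=; rewrite !in_itv /= !andbT; apply.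
pose D := CF * 2 `^ b'.
have D0 : 0 < D by rewrite mulr_gt0// powR_gt0.
have FD r : 0 < r -> F (2 * r) <= D * F r.
  move=> r0; have [|_] := andP (hF r (2 * r) r0 _); first by lra.
  by rewrite ler_pdivrMr ?F0// mulfK ?gt_eqF.
(* [P(tau > t) >= 1 / K] will hold; [1 / (K + 1)] is moreover smaller than one *)
pose K := 8 * C ^+ 2 * D.
have K0 : 0 < K by rewrite !mulr_gt0// exprn_gt0.
exists ((2 * C)^-1), (1 - (K + 1)^-1); split.
- by rewrite invr_gt0 mulr_gt0.
- by rewrite invf_lt1 ?mulr_gt0//; lra.
- by rewrite subr_gt0 invf_lt1; lra.
- by rewrite gtrBl invr_gt0; lra.
move=> x r Nx r0.
have oB := open_mball x r; have mE := exit_measurable XD oB.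
have Fr := F0 r r0.
have F2r : 0 < F (2 * r) by rewrite F0// mulr_gt0.
set t := (2 * C)^-1 * F r; pose m := C * F (2 * r).
have t0 : 0 < t by rewrite mulr_gt0// invr_gt0 mulr_gt0.
have m0 : 0 < m by rewrite mulr_gt0.
have half y : ball x r y -> ~ N0 y ->
    (PP y [set w | (2 * m)%:E < exit_time X (ball x r) w]%E <= (2^-1)%:E)%E.
  move=> By Ny; have xy : mdist x y < r by move: By; rewrite ballEmdist.
  apply: (exit_tail_half xy m0).
  by have [] := EF y (2 * r) Ny _ => //; rewrite mulr_gt0.
have m20 : 0 < 2 * m by rewrite mulr_gt0.
have := mean_le_tail mE (exit_time_ge0 X _) (ltW t0) m20
  (fun k => exit_tail_geometric k oB Nx t0 half (ltW m20)).
have [lower _] := EF x r Nx r0.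
move=> /(le_trans lower); have mgt := exit_gt_measurable XD t oB.
rewrite (probability_fineK (PP x) mgt) -EFinM -EFinD lee_fin.
set q := fine _ => main.
have q0 : 0 <= q by rewrite fine_ge0.
rewrite (_ : [set w | _] = ~` [set w | t%:E < exit_time X (ball x r) w]%E); last first.
  by apply/seteqP; split=> w /=; rewrite leNgt; move/negP.
rewrite probability_setC// (probability_fineK (PP x) mgt) -EFinB lee_fin -/q.
rewrite lerD2l lerN2.
suff : 1 <= K * q.
  move=> Kq; rewrite -[leLHS]mul1r ler_pdivrMr; last by lra.
  by rewrite mulrDr mulr1 mulrC; lra.
have mD : m <= C * (D * F r) by rewrite ler_pM2l// FD.
have tE : C^-1 * F r = 2 * t by rewrite /t; field; rewrite gt_eqF.
have h1 : t <= 4 * (C * (D * F r)) * q.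
  apply: (@le_trans _ _ (2 * (2 * m) * q)); first by lra.
  by apply: ler_wpM2r => //; lra.
have : 2 * C * t <= 2 * C * (4 * (C * (D * F r)) * q) by rewrite ler_pM2l ?mulr_gt0.
have -> : 2 * C * t = F r * 1.
  by rewrite /t; field; rewrite gt_eqF.
have -> : 2 * C * (4 * (C * (D * F r)) * q) = F r * (K * q) by rewrite /K; ring.
by rewrite ler_pM2l.
Qed.

End small_exit.

(** * Concentric balls *)

Section concentric_balls.
Context {R : realType} {d : measure_display} {M : borelMetricType R d}.
Context {d' : measure_display} {Omega : measurableType d'}.
Variables (mu : {measure set M -> \bar R}).
Variables (N0 : set M) (X : R -> Omega -> one_point_compactification M)
  (theta : R -> Omega -> Omega) (Ft : R -> set (set Omega))
  (PP : M -> probability Omega R).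
Hypothesis XD : diffusion N0 X theta Ft PP.
Hypothesis NE : properly_exceptional mu X PP N0.
Implicit Types (U : set M) (w : Omega) (x y : M) (r s t u v rho : R).

(** Before [s] the path is in the ball, so by continuity [X s w] is adherent to it;
    the cemetery is excluded because it has a neighbourhood that avoids the
    compact closure of the ball. *)
Lemma exit_position x r w s : precompact (ball x r) ->
  exit_time X (ball x r) w = s%:E -> 0 < s ->
  exists2 y, X s w = Some y & mdist x y <= r.
Proof.
move=> cB Es s0.
have inB v : 0 < v -> v < s -> inside X (ball x r) v w.
  by move: v; apply/le_exit_timeP; rewrite Es.
have before (V : set (one_point_compactification M)) : open V -> V (X s w) ->
    exists2 z, mdist x z < r & V (Some z).
  move=> oV VX; have [e e0 eV] := path_near XD (ltW s0) oV VX.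
  have : Num.max 0 (s - e) < s by rewrite gt_max s0 gtrBl e0.
  move=> /rat_in_itvoo[q]; rewrite in_itv /= gt_max => /andP[/andP[q0 eq] qs].
  have [z] := inB _ q0 qs; rewrite ballEmdist /= => xz Xq.
  exists z => //; rewrite Xq; apply: eV; first exact: ltW.
  by rewrite distrC ger0_norm ?subr_ge0 ?(ltW qs)// ltrBlDr addrC -ltrBlDr.
case Xs : (X s w) => [y|].
  exists y => //; rewrite leNgt; apply/negP => ry.
  have e0 : 0 < mdist x y - r by rewrite subr_gt0.
  have [||z xz] := before (Some @` ball y (mdist x y - r)).
  - by apply: one_point_compactification_open_some; exact: open_mball.
  - by rewrite Xs; exists y => //; exact: ballxx.
  case=> z'; rewrite ballEmdist /= => yz [zz']; move: yz; rewrite zz' => yz.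
  by have := metric_triangle x z y; rewrite (metric_sym z y); lra.
pose V : set (one_point_compactification M) :=
  (Some @` (~` closure (ball x r))) `|` [set None].
have VN : nbhs (None : one_point_compactification M) V.
  exists (closure (ball x r)) => //; split; last exact: closed_closure.
  by rewrite -precompactE.
have [||z xz] := before V°; first exact: open_interior.
  by rewrite Xs.
move=> /interior_subset[[z' nz' [zz']]|//].
by exfalso; apply: nz'; rewrite zz'; apply: subset_closure; rewrite ballEmdist.
Qed.

(** Almost every path starts at [x] and stays in the ball for a positive time. *)
Lemma exit_le0 x r : ~ N0 x -> 0 < r ->
  PP x [set w | exit_time X (ball x r) w <= 0]%E = 0%E.
Proof.
move=> Nx r0; have oB := open_mball x r.
have mS : measurable (inside X [set x] 0).
  apply: (@inside_closed_salg _ _ _ _ _ _ _ 1 (@sigma_algebra_measurable _ _)) => //.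
    by move=> t V t0 _; exact: (adapted_measurable XD).
  by apply: accessible_closed_set1; apply: hausdorff_accessible; exact: metric_hausdorff.
have S1 : PP x (inside X [set x] 0) = 1%E.
  rewrite -(diff_start XD Nx); congr (PP x _); apply/seteqP; split=> w /=.
    by case=> _ -> <-.
  by move=> Xx; exists x.
apply/eqP; rewrite eq_le measure_ge0 andbT.
apply: (@le_trans _ _ (PP x (~` inside X [set x] 0))).
  apply: le_measure; rewrite ?inE; [exact: (exit_le_measurable XD)|exact: measurableC|].
  move=> w /= e0 [_ -> X0].
  have [||e ep eB] := path_near XD (lexx 0) (V := Some @` ball x r) (w := w).
  - exact: one_point_compactification_open_some.
  - by exists x => //; exact: ballxx.
  have : (e%:E <= exit_time X (ball x r) w)%E.
    apply/le_exit_timeP => v v0 ve; apply: eB; first exact: ltW.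
    by rewrite subr0 ger0_norm // ltW.
  by move=> /le_trans/(_ e0); rewrite lee_fin leNgt ep.
by rewrite probability_setC// S1 subee.
Qed.

(** If [B(x, r + rho)] is left before [t] while [B(x, r)] is not left before
    [t' >= t - s], then going from the boundary of the smaller ball to the
    complement of the larger one takes at most [s].  This requires leaving a ball
    of radius [rho] around the position at which the smaller ball is left.  As
    [t' >= 0], only paths with a positive first exit time contribute to the last
    term, which excludes those that do not start at [x]. *)
Lemma exit_step x r rho s t t' (p : R) : ~ N0 x -> precompact (ball x r) ->
  0 < rho -> 0 <= p -> 0 <= t' -> t' <= t -> t - s <= t' ->
  (forall y, ~ N0 y ->
    (PP y [set w | exit_time X (ball y rho) w <= s%:E]%E <= p%:E)%E) ->
  (PP x [set w | exit_time X (ball x (r + rho)) w <= t%:E]%E <=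
   PP x [set w | exit_time X (ball x r) w <= t'%:E]%E +
   p%:E * PP x ([set w | exit_time X (ball x r) w <= t%:E]%E `\`
                [set w | exit_time X (ball x r) w <= t'%:E]%E))%E.
Proof.
move=> Nx cB rho0 p0 t'0 t't tst' hp.
have oB := open_mball x r; have oB' := open_mball x (r + rho).
have FF := diff_filtration XD.
set A := _ `\` _.
pose C := A `&` [set w | exit_time X (ball x (r + rho)) w <=
                         exit_time X (ball x r) w + s%:E]%E.
have mle u U : open U -> measurable [set w | (exit_time X U w <= u%:E)%E].
  by move=> oU; exact: (exit_le_measurable XD).
have mA : measurable A by apply: measurableD; exact: mle.
have mC : measurable C.
  apply: measurableI => //; rewrite -[X in measurable X]setTI.
  apply: measurable_lee => //; first exact: (exit_measurable XD).
  by apply: emeasurable_funD => //; exact: (exit_measurable XD).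
have onA w : A w -> exists2 u, exit_time X (ball x r) w = u%:E & 0 < u.
  case=> /= et /negP; rewrite -ltNge; move: et.
  case: (exit_time X (ball x r) w) => [u||] //= _.
  by rewrite lte_fin => t'u; exists u => //; exact: le_lt_trans t'u.
have onA' w : A w -> exit_time X (ball x (r + rho)) w =
    (exit_time X (ball x r) w + exit_time X (ball x (r + rho))
       (theta (fine (exit_time X (ball x r) w)) w))%E.
  move=> /onA[u Eu u0]; rewrite Eu /=; apply: (exit_shift XD); first exact: ltW.
  move=> v v0 vu; have [vu'|uv] := ltP v u.
    apply: (@inside_sub _ _ _ _ _ _ (ball x r)).
      by apply: le_ball; rewrite lerDl ltW.
    by apply: (proj1 (le_exit_timeP X (ball x r) w u)) => //; rewrite Eu.
  have -> : v = u by apply/eqP; rewrite eq_le vu.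
  have [y Xy xy] := exit_position cB Eu u0.
  by exists y => //; rewrite ballEmdist /=; lra.
apply: (@le_trans _ _ (PP x ([set w | exit_time X (ball x r) w <= t'%:E]%E `|` C))).
  apply: le_measure; rewrite ?inE; [exact: mle|by apply: measurableU => //; exact: mle|].
  move=> w /= e't; have [et'|nt'] := pselect (exit_time X (ball x r) w <= t'%:E)%E.
    by left.
  right; have et : (exit_time X (ball x r) w <= t%:E)%E.
    apply: le_trans (exit_time_sub X w _) e't.
    by apply: le_ball; rewrite lerDl ltW.
  split; first by split.
  apply: le_trans e't _; move/negP : nt'; rewrite -ltNge.
  move: et; case: (exit_time X (ball x r) w) => [u||] //= _.
  by rewrite lte_fin -EFinD lee_fin; lra.
apply: le_trans (measureU2 _ _ _) _ => //; first exact: mle.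
apply: leeD2l.
apply: (markov_bound XD NE (sigma := exit_time X (ball x r))
  (B := [set w | exit_time X (ball x (r + rho)) w <= s%:E]%E)) => //.
- exact: (exit_stopping XD).
- exact: (exit_measurable XD).
- split=> // u u0.
  have sF := filtration_sigma FF u0.
  have Fle v : v <= u -> Ft u [set w | exit_time X (ball x r) w <= v%:E]%E.
    move=> vu; have [v0|v0] := leP 0 v.
      apply: (filtration_mono FF v0 vu).
      by have [_] := exit_stopping XD oB; exact.
    by rewrite exit_le_neg//; have [] := sF.
  suff -> : A `&` [set w | exit_time X (ball x r) w <= u%:E]%E =
      [set w | (exit_time X (ball x r) w <= (Num.min t u)%:E)%E /\
        ~ (exit_time X (ball x r) w <= (Num.min t' u)%:E)%E].
    apply: salg_and => //; first by apply: Fle; rewrite ge_min lexx orbT.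
    by apply: salg_not => //; apply: Fle; rewrite ge_min lexx orbT.
  apply/seteqP; split=> w /=; rewrite !EFin_min !le_min.
    case=> -[/= et nt'] eu; rewrite et eu; split=> //.
    by rewrite andbT.
  by case=> /andP[et eu]; rewrite eu andbT => nt'.
- exact: (exit_path_events XD).
- apply/seteqP; split=> w [Aw /= h]; split=> //=; move: h.
    rewrite onA' //; have [u Eu u0] := onA w Aw.
    by rewrite Eu leeD2lE.
  move=> h; rewrite onA' //; have [u Eu u0] := onA w Aw.
  by rewrite Eu leeD2lE // -[X in exit_time _ _ (theta X _)]/(fine u%:E) -Eu.
- move=> w Aw; have [u Eu u0] := onA w Aw.
  have [y Xy xy] := exit_position cB Eu u0.
  rewrite /at_time Eu ltry; split=> //; exists y => // Ny.
  apply: le_trans (hp y Ny); apply: le_measure; rewrite ?inE.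
  + exact: mle.
  + by apply: mle; exact: open_mball.
  move=> w' /=; apply: le_trans; apply: exit_time_sub => z.
  rewrite !ballEmdist /= => yz.
  by have := metric_triangle x y z; lra.
Qed.

(** The factor [(1 + p) / 2] comes from [(1 - p) / e + p <= (1 - p) / 2 + p], the term
    [1 / e] being the cost of replacing [t] by [t - s] in the exponential. *)
Lemma exit_concentric x rho s (p : R) n t : ~ N0 x -> 0 < rho -> 0 < s ->
  0 < p -> p < 1 -> precompact (ball x (n.+1%:R * rho)) ->
  (forall y, ~ N0 y ->
    (PP y [set w | exit_time X (ball y rho) w <= s%:E]%E <= p%:E)%E) ->
  0 <= t ->
  (PP x [set w | exit_time X (ball x (n.+1%:R * rho)) w <= t%:E]%E <=
   (((1 + p) / 2) ^+ n * expR (t / s))%:E)%E.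
Proof.
move=> Nx rho0 s0 p0 p1 + hp; elim: n t => [|n IH] t cB t0.
  rewrite expr0 mul1r; apply: (@le_trans _ _ 1%E).
    by apply: probability_le1; apply: (exit_le_measurable XD); exact: open_mball.
  by rewrite lee_fin -expR0 ler_expR divr_ge0// ltW.
have cB' : precompact (ball x (n.+1%:R * rho)).
  apply: precompact_subset cB; apply: le_ball.
  by rewrite ler_pM2r// ler_nat.
have {}IH u := IH u cB'.
pose t' := Num.max 0 (t - s).
have t'0 : 0 <= t' by rewrite le_max lexx.
have t't : t' <= t by rewrite ge_max t0 gerBl ltW.
have tst' : t - s <= t' by rewrite le_max lexx orbT.
have := exit_step Nx cB' rho0 (ltW p0) t'0 t't tst' hp.
have -> : n.+1%:R * rho + rho = n.+2%:R * rho by rewrite -[n.+2%:R]natr1 mulrDl mul1r.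
move=> /le_trans; apply.
have oB := open_mball x (n.+1%:R * rho).
set S := [set w | exit_time X (ball x (n.+1%:R * rho)) w <= t%:E]%E.
set S' := [set w | exit_time X (ball x (n.+1%:R * rho)) w <= t'%:E]%E.
have mS : measurable S by exact: (exit_le_measurable XD).
have mS' : measurable S' by exact: (exit_le_measurable XD).
have SS : S `&` S' = S'.
  by apply: setIidr => w /= /le_trans; apply; rewrite lee_fin.
have : PP x S = (PP x (S `\` S') + PP x S')%E by rewrite -[in X in (_ + X)%E]SS; exact: measureDI.
rewrite (probability_fineK (PP x) mS) (probability_fineK (PP x) mS').
rewrite (probability_fineK (PP x) (measurableD mS mS')).
rewrite -EFinM -!EFinD => -[bE]; rewrite lee_fin.
set a := fine _ in bE *; set a' := fine (PP x S') in bE *.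
set e := fine _ in bE *.
set q := (1 + p) / 2; set E := expR (t / s).
have q0 : 0 <= q by rewrite /q; lra.
have E0 : 0 <= E by exact: expR_ge0.
have ale : a <= q ^+ n * E.
  by have := IH t t0; rewrite -/S (probability_fineK (PP x) mS) lee_fin.
have a'le : a' <= q ^+ n * E / 2.
  have [st|ts] := leP s t.
    have := IH t' t'0; rewrite -/S' (probability_fineK (PP x) mS') lee_fin.
    move=> /le_trans; apply; rewrite -mulrA ler_wpM2l ?exprn_ge0//.
    have -> : t' / s = t / s + - 1.
      by rewrite /t' max_r ?subr_ge0// mulrBl divff ?gt_eqF.
    rewrite expRD ler_wpM2l// expRN lef_pV2 ?posrE ?expR_gt0//.
    by have := expR_ge1Dx (1 : R); lra.
  have t'E : t' = 0 by rewrite /t' max_l// subr_le0 ltW.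
  rewrite /a' /S' t'E exit_le0 ?mulr_gt0//=.
  by rewrite mulr_ge0 ?mulr_ge0 ?exprn_ge0// invr_ge0.
have eE : e = a - a' by rewrite bE addrK.
rewrite exprS eE (_ : a' + p * (a - a') = (1 - p) * a' + p * a); last by ring.
have h1 : (1 - p) * a' <= (1 - p) * (q ^+ n * E / 2) by rewrite ler_wpM2l//; lra.
have h2 : p * a <= p * (q ^+ n * E) by rewrite ler_wpM2l// ltW.
apply: le_trans (lerD h1 h2) _; rewrite le_eqVlt; apply/orP; left; apply/eqP.
by rewrite -/q /q; field.
Qed.

End concentric_balls.

(** * Optimisation over the scale *)

Section optimisation.
Context {R : realType} {d : measure_display} {M : borelMetricType R d}.
Context {d' : measure_display} {Omega : measurableType d'}.
Variables (mu : {measure set M -> \bar R}).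
Variables (N0 : set M) (X : R -> Omega -> one_point_compactification M)
  (theta : R -> Omega -> Omega) (Ft : R -> set (set Omega))
  (PP : M -> probability Omega R).
Hypothesis XD : diffusion N0 X theta Ft PP.
Hypothesis NE : properly_exceptional mu X PP N0.

(** With [n] the integer part of [r / rho], the [n] concentric balls give [n - 1]
    factors [exp (- c)] and [n - 1 > r / rho - 2], whence the constant [exp (2 c)]. *)
Lemma exit_exponential x (r rho s t p c : R) :
  c = - ln ((1 + p) / 2) -> ~ N0 x -> 0 < r -> 0 < rho ->
  0 < s -> 0 < p -> p < 1 -> precompact (ball x r) ->
  (forall y, ~ N0 y ->
    (PP y [set w | exit_time X (ball y rho) w <= s%:E]%E <= p%:E)%E) ->
  0 <= t ->
  (PP x [set w | exit_time X (ball x r) w <= t%:E]%E <=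
   (expR (2 * c) * expR (- (c * (r / rho) - t / s)))%:E)%E.
Proof.
move=> cE Nx r0 rho0 s0 p0 p1 cB hp t0; move: cE.
set q := (1 + p) / 2; have q0 : 0 < q by rewrite /q; lra.
have q1 : q < 1 by rewrite /q; lra.
move=> cE; have c0 : 0 < c by rewrite cE oppr_gt0 ln_lt0// q0.
have ts0 : 0 <= t / s by rewrite divr_ge0// ltW.
have rr0 : 0 <= r / rho by rewrite divr_ge0// ltW.
have oB := open_mball x r.
rewrite -expRD; have /andP[] := truncn_itv rr0.
case: (Num.truncn (r / rho)) => [|n] nr rn.
  apply: (@le_trans _ _ 1%E).
    by apply: probability_le1; exact: (exit_le_measurable XD).
  rewrite lee_fin -[leLHS]expR0 ler_expR.
  have : 0 <= c * (1 - r / rho) by apply: mulr_ge0; [exact: ltW|rewrite subr_ge0 ltW].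
  move: ts0 c0; set y := t / s; set z := r / rho => y0 {}c0.
  by rewrite mulrBr; lra.
have nB : ball x (n.+1%:R * rho) `<=` ball x r.
  by apply: le_ball; rewrite -ler_pdivlMr.
have cB' := precompact_subset nB cB.
apply: le_trans (le_trans _ (exit_concentric XD NE (n := n) Nx rho0 s0 p0 p1 cB' hp t0)) _.
  apply: le_measure; rewrite ?inE; [exact: (exit_le_measurable XD)| |].
    by apply: (exit_le_measurable XD); exact: open_mball.
  by move=> w /=; apply: le_trans; exact: exit_time_sub.
rewrite lee_fin -/q -[q in q ^+ n]lnK ?posrE// -expRM_natl -expRD ler_expR.
have -> : ln q = - c by rewrite cE opprK.
have : 0 <= c * (n.+2%:R - r / rho) by apply: mulr_ge0; [exact: ltW|rewrite subr_ge0 ltW].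
have -> : n.+2%:R = n%:R + 2 :> R by rewrite -addn2 natrD.
rewrite -mulr_natl; move: ts0 c0; set y := t / s; set z := r / rho => y0 {}c0.
by rewrite mulrBr mulrDr; lra.
Qed.

End optimisation.

(** If [q > 0], taking logarithms turns the bounds into a finite upper bound of [S];
    thus the supremum can only be infinite when [q = 0]. *)
Lemma le_expeRN_ereal_sup (R : realType) (C : R) (S : set (\bar R)) (q : \bar R) :
  0 < C -> S !=set0 -> (0 <= q)%E -> (q <= 1)%E ->
  (forall v, S v -> q <= C%:E * expeR (- v))%E ->
  (q <= C%:E * expeR (- ereal_sup S))%E.
Proof.
move=> C0 [v0 Sv0] q0 q1 hS.
case: q q0 q1 hS => [q||]// q0 q1 hS; rewrite ?lee_fin in q0.
have [->|qn0] := eqVneq q 0.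
  by rewrite mule_ge0// ?expeR_ge0// lee_fin ltW.
have {}q0 : 0 < q by rewrite lt_neqAle eq_sym qn0.
have qC0 : 0 < q / C by rewrite divr_gt0.
have : (ereal_sup S <= (- ln (q / C))%:E)%E.
  apply: ge_ereal_sup => v Sv; have := hS v Sv.
  rewrite -lee_pdivrMl// -EFinM mulrC.
  have -> : (q / C)%:E = expeR (ln (q / C))%:E by rewrite /= lnK.
  by rewrite lee_expeR EFinN leeNr.
move=> h; rewrite -lee_pdivrMl// -EFinM mulrC.
have -> : (q / C)%:E = expeR (ln (q / C))%:E by rewrite /= lnK.
by rewrite lee_expeR -leeNr -EFinN.
Qed.

Theorem theorem3p15 (R : realType) (d d' : measure_display)
  (M : borelMetricType R d) (Omega : measurableType d')
  (mu : {measure set M -> \bar R})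
  (dom : set (M -> R)) (E : (M -> R) -> (M -> R) -> R)
  (P : R -> (M -> R) -> (M -> R))
  (N0 : set M) (X : R -> Omega -> one_point_compactification M)
  (theta : R -> Omega -> Omega) (Ft : R -> set (set Omega))
  (PP : M -> probability Omega R) (F : R -> R)
  (M_locally_compact : locally_compact [set: M])
  (M_separable : separable M)
  (mu_radon : radon mu) (mu_full : full_support mu)
  (E_dirichlet : dirichlet_form mu dom E)
  (E_regular : regular_form mu dom E)
  (E_strongly_local : strongly_local mu dom E)
  (P_heat : heat_semigroup mu dom E P)
  (X_diffusion : diffusion N0 X theta Ft PP)
  (N0_exceptional : properly_exceptional mu X PP N0)
  (X_associated : associated mu P X PP)
  (F_scale : scale_function F)
  (EF : cond_EF F N0 X PP) :
  exists C gamma : R, [/\ 0 < C, 0 < gamma &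
    forall (x : M) (r t : R), ~ N0 x -> 0 < r -> precompact (ball x r) ->
      0 < t ->
      (PP x [set w | exit_time X (ball x r) w <= t%:E] <=
       C%:E * expeR (- Phi F (gamma * r) t))%E].
Proof.
have [delta [p [delta0 delta1 p0 p1 hp]]] :=
  small_exit X_diffusion N0_exceptional F_scale EF.
have [b [b' [CF [b1 _ CF1 hF]]]] := scale_bounds F_scale.
have F0 r : 0 < r -> 0 < F r.
  move=> r0; have [+ _ _] := scale_bij F_scale.
  by move=> /(_ r) /=; rewrite !in_itv /= !andbT; apply.
have CF0 : 0 < CF by rewrite (lt_trans ltr01).
pose c := - ln ((1 + p) / 2).
have c0 : 0 < c by rewrite oppr_gt0 ln_lt0//; apply/andP; split; lra.
(* as [b > 1], [F (kappa * r) >= CF^-1 * kappa * F r = F r / delta] *)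
pose kappa := CF / delta.
have kappa1 : 1 <= kappa by rewrite ler_pdivlMr//; lra.
have kappa0 : 0 < kappa by rewrite (lt_le_trans ltr01).
have deltaF r : 0 < r -> F r <= delta * F (kappa * r).
  move=> r0; have Fr := F0 r r0.
  have /andP[+ _] := hF r (kappa * r) r0 (ler_peMl (ltW r0) kappa1).
  rewrite mulfK ?gt_eqF// ler_pdivlMr// => h.
  have kb : kappa <= kappa `^ b.
    by rewrite -[leLHS]powRr1 ?(ltW kappa0)// ler_powR// ltW.
  have : CF^-1 * kappa * F r <= F (kappa * r).
    apply: le_trans h; apply: ler_wpM2r; first exact: ltW.
    by rewrite ler_pM2l ?invr_gt0.
  have -> : CF^-1 * kappa * F r = F r / delta.
    by rewrite /kappa; field; rewrite !gt_eqF.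
  by rewrite ler_pdivrMr// mulrC.
exists (expR (2 * c)), (c / kappa); split; [exact: expR_gt0|exact: divr_gt0|].
move=> x r t Nx r0 cB t0.
apply: le_expeRN_ereal_sup; first exact: expR_gt0.
- by exists (c / kappa * r / 1 - t / F 1)%:E; exists 1 => //=; rewrite in_itv /= ltr01.
- exact: measure_ge0.
- by apply: probability_le1; apply: (exit_le_measurable X_diffusion); exact: open_mball.
move=> v [u u_in <-]; have u0 : 0 < u by move: u_in; rewrite /= in_itv /= andbT.
have ku0 : 0 < kappa * u by rewrite mulr_gt0.
have Fku : 0 < F (kappa * u) by exact: F0.
have s0 : 0 < delta * F (kappa * u) by rewrite mulr_gt0.
apply: le_trans (exit_exponential X_diffusion N0_exceptional (erefl c) Nx r0 ku0 s0 p0 p1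
  cB _ (ltW t0)) _.
  by move=> y Ny; exact: hp.
rewrite -EFinM lee_fin ler_pM2l ?expR_gt0// ler_expR -/c lerN2.
have -> : c / kappa * r / u = c * (r / (kappa * u)).
  by field; rewrite !gt_eqF.
rewrite lerD2l lerN2 ler_pM2l// lef_pV2 ?posrE//; last exact: F0.
exact: deltaF.
Qed.
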